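(* Let $m,n$ be positive integers and $s,k$ even positive integers. There exists an integer ${}^2\mathrm{H}(m,n;s,k)$ if and only if $ms=nk$, $2\le s\le n$, $2\le k\le m$, and (1) if $s=2$, then either $n=2$ and $m=k\equiv 0\pmod 4$, or $n,k\ge 3$; (2) if $k=2$, then either $m=2$ and $n=s\equiv 0\pmod 4$, or $m,s\ge 3$.
   Context: For positive integers $m,n,s,k,\lambda,t$ with $t$ dividing $\frac{2nk}{\lambda}$, let $v=\frac{2nk}{\lambda}+t$ and $J$ the subgroup of $\mathbb{Z}_v$ of order $t$. A ${}^\lambda\mathrm{H}_t(m,n;s,k)$ is an $m\times n$ partially filled array with entries in $\mathbb{Z}_v$ such that: (a) each row has exactly $s$ and each column exactly $k$ filled cells; (b) the multiset $\{\pm x: x$ an entry of a filled cell$\}$ contains each element of $\mathbb{Z}_v\setminus J$ exactly $\lambda$ times and no element of $J$; (c) every row and every column sums to $0$ in $\mathbb{Z}_v$. The subscript $t$ is omitted when $t=1$, so ${}^2\mathrm{H}(m,n;s,k)$ is over $\mathbb{Z}_{nk+1}$. The array is integer if, representing each entry by its integer representative in $\pm\{1,\dots,\lfloor v/2\rfloor\}$, every row and every column sums to $0$ in $\mathbb{Z}$. *)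

(* Defs.v *)
From mathcomp Require Import all_boot all_order all_algebra.
Set Implicit Arguments. Unset Strict Implicit. Unset Printing Implicit Defensive.
Import Order.TTheory GRing.Theory Num.Theory.

(* A ^2H(m,n;s,k): lambda = 2, t = 1, so v = nk+1 and J = {0}.
   An m x n partially filled array with entries in Z_v is a function
   'I_m -> 'I_n -> option 'I_v  (None = empty cell; an element of Z_v is
   represented by its residue in {0,...,v-1}). *)

Definition hv (n k : nat) : nat := (n * k).+1.

Definition parray (m n v : nat) := 'I_m -> 'I_n -> option 'I_v.

Definition row_filled m n v (A : parray m n v) (i : 'I_m) : nat :=
  #|[set j : 'I_n | A i j != None]|.
Definition col_filled m n v (A : parray m n v) (j : 'I_n) : nat :=
  #|[set i : 'I_m | A i j != None]|.

Definition cval v (x : option 'I_v) : nat := if x is Some y then val y else 0.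

(* multiplicity of r in the multiset {+-x : x an entry of a filled cell}:
   cells with x = r, plus cells with -x = r (i.e. x + r = 0 mod v). *)
Definition pm_mult m n v (A : parray m n v) (r : 'I_v) : nat :=
  #|[set ij : 'I_m * 'I_n | A ij.1 ij.2 == Some r]| +
  #|[set ij : 'I_m * 'I_n |
      if A ij.1 ij.2 is Some x then (val x + val r) %% v == 0 else false]|.

Definition irep v (x : option 'I_v) : int :=
  if x is Some y then
    (if (val y <= v %/ 2)%N then (val y)%:Z else (val y)%:Z - v%:Z)%R
  else 0%R.

Definition heffter2 (m n s k : nat) (A : parray m n (hv n k)) : Prop :=
  let v := hv n k in
  (forall i, row_filled A i = s) /\ (forall j, col_filled A j = k) /\
  (* (b) with lambda = 2, J = {0} *)
  (forall r : 'I_v, pm_mult A r = (if val r == 0 then 0 else 2)) /\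
  (forall i, (\sum_(j < n) cval (A i j)) %% v = 0) /\
  (forall j, (\sum_(i < m) cval (A i j)) %% v = 0).

Arguments heffter2 : clear implicits.

Definition integer_heffter2 (m n s k : nat) (A : parray m n (hv n k)) : Prop :=
  heffter2 m n s k A /\
  (forall i, (\sum_(j < n) irep (A i j))%R = 0%R) /\
  (forall j, (\sum_(i < m) irep (A i j))%R = 0%R).
Arguments integer_heffter2 : clear implicits.

(* Main.v *)
(* An integer ^2H(m,n;s,k) amounts to an m x n array of integers with zero row
   and column sums in which every x in 1..nk/2 occurs exactly twice up to sign.
   If each label occurs as a pair (x, -x) inside one row, row sums vanish and
   the array is a k-regular multigraph on the n columns: the edge labelled x
   joins the columns of x and -x, the labels form a flow, and the edges are
   split into m matchings of s/2 edges, one per row.  Listing the edges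
   cyclically so that any s/2 consecutive ones are disjoint, it remains to
   label.
   - n odd: the Hamiltonian cycle with multiplicity k/2, where parallel labels
     have the same signed sum on every edge of the cycle.
   - n even, and 4 | k or 4 | n: a perfect matching with multiplicity k, where
     parallel labels sum to 0.
   - n = k = 2 mod 4: the sum of all labels is then odd, which rules out
     bipartite multigraphs, and four columns carry a K4 instead.
   Transposition covers the remaining parameters. For the necessity, s = 2 and
   n = 2 gives +-1 +- ... +- m = 0, hence 4 | m; s = k = 2 would make |x| = 1
   occur three times. *)

Require Import Defs.
From mathcomp Require Import all_boot all_order all_algebra.
From mathcomp Require Import zify.
Set Implicit Arguments. Unset Strict Implicit. Unset Printing Implicit Defensive.
Import Order.TTheory GRing.Theory Num.Theory.

(** * Integer arrays with zero row and column sums *)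

(** Condition (b) forbids the entry 0, so 0 can encode an empty cell. For a
    ${}^2\mathrm{H}(m,n;s,k)$ the bound [N] is nk/2. *)
Definition iarray m n s k N (f : 'I_m -> 'I_n -> int) : Prop :=
  [/\ forall i, \sum_j (f i j != 0%R) = s,
      forall j, \sum_i (f i j != 0%R) = k,
      forall x, 0 < x <= N -> \sum_i \sum_j (`|f i j|%N == x) = 2,
      forall i j, `|f i j|%N <= N &
      (forall i, (\sum_j f i j = 0)%R) /\ (forall j, (\sum_i f i j = 0)%R)].
Arguments iarray : clear implicits.

Lemma iarray_tr m n s k N f :
  iarray m n s k N f -> iarray n m k s N (fun j i => f i j).
Proof.
case=> fs fk fx fN [fr fc]; split=> // x xN.
by rewrite exchange_big /= fx.
Qed.

Lemma sum_ord_eq m (x : nat) : x < m -> \sum_(i < m) (x == i :> nat) = 1.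
Proof.
move=> xm; rewrite (bigD1 (Ordinal xm)) //= eqxx big1 // => i.
by rewrite -val_eqE /= eq_sym => /negbTE ->.
Qed.

Lemma sum_ord_pick m (F : nat -> int) (x : nat) :
  x < m -> (\sum_(i < m) (x == i :> nat)%:Z * F i = F x)%R.
Proof.
move=> xm; rewrite (bigD1 (Ordinal xm)) //= eqxx mul1r big1 ?addr0 // => i.
by rewrite -val_eqE /= eq_sym => /negbTE ->; rewrite mul0r.
Qed.

(** * Arrays from labelled multigraphs *)

Section Multigraph.
Variables (E : finType) (row tl hd : E -> nat) (L : E -> int).

(** Edge [e] puts [L e] in column [tl e] and [- L e] in column [hd e] of its row. The sum only makes
    the formula total: edges of one row are disjoint, so at most one term is nonzero. *)
Definition mg_cell (i j : nat) : int :=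
  (\sum_(e | row e == i) ((tl e == j)%:Z - (hd e == j)%:Z) * L e)%R.

Hypothesis row_matching : forall e e', row e = row e' ->
  [/\ tl e <> hd e', tl e = tl e' -> e = e' & hd e = hd e' -> e = e'].

(** At most one edge end falls in a cell, so any [phi] vanishing at 0 commutes with the sum. Taking
    indicator functions for [phi] yields all the cell counts. *)
Lemma mg_cellE (phi : int -> nat) i j : phi 0%R = 0 ->
  phi (mg_cell i j) = \sum_(e | row e == i)
     ((tl e == j) * phi (L e) + (hd e == j) * phi (- L e)%R).
Proof.
move=> phi0; rewrite /mg_cell.
have [e0 /andP[/eqP r0 /orP t0]|noe] :=
  pickP (fun e => (row e == i) && ((tl e == j) || (hd e == j))); last first.
  have noe' e : row e == i -> (tl e == j) = false /\ (hd e == j) = false.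
    by move=> re; move: (noe e); rewrite re /= => /norP[/negbTE -> /negbTE ->].
  rewrite [X in phi X]big1 ?phi0 ?big1 // => e /noe'[-> ->] //.
  by rewrite subrr mul0r.
have nz e : row e = i -> e != e0 -> (tl e == j) = false /\ (hd e == j) = false.
  move=> re ne; rewrite -r0 in re; have [a b c] := row_matching re.
  have [a' _ _] := row_matching (esym re).
  by case: t0 => /eqP t0; split; apply/negbTE/eqP=> h;
    (try by apply: a; rewrite t0); (try by apply: a'; rewrite t0);
    move/eqP: ne; apply; (try (by apply: b; rewrite t0)); apply: c; rewrite t0.
rewrite (bigD1 e0) ?r0 //= big1 ?addr0; last first.
  by move=> e /andP[/eqP re /(nz _ re)[-> ->]]; rewrite subrr mul0r.
rewrite (bigD1 e0) ?r0 //= big1 ?addn0; last first.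
  by move=> e /andP[/eqP re /(nz _ re)[-> ->]].
have [a _ _] := row_matching (erefl (row e0)).
case: t0 => /eqP t0.
  have ->: (hd e0 == j) = false by apply/negbTE/eqP => h; apply: a; rewrite t0.
  by rewrite t0 eqxx subr0 mul1r mul1n mul0n addn0.
have ->: (tl e0 == j) = false by apply/negbTE/eqP => h; apply: a; rewrite t0.
by rewrite t0 eqxx sub0r mulN1r mul1n mul0n add0n.
Qed.

Variables (m n s k : nat).
Hypotheses (row_lt : forall e, row e < m) (tl_lt : forall e, tl e < n)
  (hd_lt : forall e, hd e < n).
Hypothesis row_size : forall i, i < m -> \sum_e (row e == i) = s.
Hypothesis degree : forall j, j < n -> \sum_e ((tl e == j) + (hd e == j)) = k.
Hypothesis flow : forall j, j < n ->
  (\sum_e ((tl e == j)%:Z - (hd e == j)%:Z) * L e = 0)%R.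
Hypothesis label_bound : forall e, 0 < `|L e|%N <= #|E|.
Hypothesis label_inj : injective (fun e => `|L e|%N).

(** An injection from [E] into 1..[#|E|] is onto; the predecessor moves this range to an ordinal
    type. *)
Lemma label_once x : 0 < x <= #|E| -> \sum_e (`|L e|%N == x) = 1.
Proof.
move=> xN.
have lt e : `|L e|%N.-1 < #|E| by have := label_bound e; lia.
pose g e := Ordinal (lt e).
have ginj : injective g.
  move=> e e' /(congr1 val) /= h; apply: label_inj => /=.
  have := label_bound e; have := label_bound e'; lia.
have xlt : x.-1 < #|E| by lia.
have gsurj : Ordinal xlt \in codom g.
  by apply: inj_card_onto => //; rewrite card_ord.
have [e ge] := codomP gsurj; move/(congr1 val): ge => /= ge.
have xe : x = `|L e|%N by have := label_bound e; lia.
rewrite (bigD1 e) //= -xe eqxx big1 // => e' ne; rewrite xe.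
by rewrite (inj_eq label_inj) (negbTE ne).
Qed.

(** Each edge contributes [L e] and [- L e] to its row, so row sums vanish and every label is met
    twice; column sums vanish by [flow]. *)
Lemma mg_iarray :
  iarray m n s.*2 k #|E| (fun i j => mg_cell i j).
Proof.
have nz e : (L e != 0)%R by have := label_bound e; lia.
have rowsum (F : E -> nat) : \sum_(i < m) \sum_(e | row e == i) F e = \sum_e F e.
  rewrite (exchange_big_dep predT) //=; apply: eq_bigr => e _.
  rewrite (bigD1 (Ordinal (row_lt e))) //= big1 ?addn0 //.
  by move=> i /andP[/eqP h]; rewrite -val_eqE /= h eqxx.
split.
- move=> i.
  under eq_bigr => j _ do rewrite (@mg_cellE (fun x => (x != 0%R))) //.
  rewrite exchange_big /=.
  rewrite (eq_bigr (fun=> 2)); last first.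
    move=> e _; rewrite big_split /= oppr_eq0 nz.
    by under eq_bigr => ? _ do rewrite muln1; rewrite sum_ord_eq //;
      under eq_bigr => ? _ do rewrite muln1; rewrite sum_ord_eq.
  by rewrite sum_nat_const -sum1_card big_mkcond -(row_size (ltn_ord i)) muln2.
- move=> j.
  under eq_bigr => i _ do rewrite (@mg_cellE (fun x => (x != 0%R))) //.
  rewrite rowsum -(degree (ltn_ord j)); apply: eq_bigr => e _.
  by rewrite oppr_eq0 nz !muln1.
- move=> x xN.
  have x0 : (`|0 : int|%N == x) = 0 :> nat by move: xN; case: x.
  under eq_bigr => i _ do
    (under eq_bigr => j _ do rewrite (@mg_cellE (fun y => `|y|%N == x)) //).
  rewrite exchange_big /=.
  under eq_bigr => j _ do rewrite rowsum.
  have -> : 2 = \sum_e 2 * (`|L e|%N == x) by rewrite -big_distrr /= label_once.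
  rewrite exchange_big /=.
  apply: eq_bigr => e _; rewrite big_split /= abszN -!big_distrl /=.
  by rewrite !sum_ord_eq // !mul1n addnn mul2n.
- move=> i j.
  rewrite leqNgt; apply/negP => big.
  have /eqP := @mg_cellE (fun y => #|E| < `|y|%N) i j erefl.
  rewrite big big1 // => e _; have := label_bound e; rewrite abszN => /andP[_].
  by rewrite leqNgt => /negbTE ->; rewrite !muln0.
split.
- move=> i; rewrite exchange_big /= big1 // => e _.
  rewrite -big_distrl /= big_split /= sumrN.
  have h (x : nat) : x < n -> (\sum_(j < n) (x == j :> nat)%:Z = 1)%R.
    move=> xn; rewrite -(sum_ord_pick (fun=> 1%R) xn).
    by apply: eq_bigr => j _; rewrite mulr1.
  by rewrite !h // subrr mul0r.
move=> j.
rewrite (exchange_big_dep predT) //= -[RHS](flow (ltn_ord j)).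
apply: eq_bigr => e _; rewrite (bigD1 (Ordinal (row_lt e))) //= big1 ?addr0 //.
by move=> i /andP[/eqP h]; rewrite -val_eqE /= h eqxx.
Qed.
End Multigraph.

(** * Rounds of edges cut into rows *)

(** By counting, the absolute values run through 1..KP exactly once; [L q r] labels edge [r] of
    round [q]. *)
Definition labelling K P (L : nat -> nat -> int) : Prop :=
  (forall q r, q < K -> r < P -> 0 < `|L q r|%N <= K * P) /\
  (forall q r q' r', q < K -> r < P -> q' < K -> r' < P ->
     `|L q r|%N = `|L q' r'|%N -> q = q' /\ r = r').

Lemma sum_block (F : nat -> nat) m s : 
  \sum_(0 <= t < m * s) F t = \sum_(i < m) \sum_(j < s) F (i * s + j).
Proof.
rewrite big_nat_mul big_mkord; apply: eq_bigr => i _.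
by rewrite mulSn addnC -{1}[_ * _]add0n big_addn addKn big_mkord; apply: eq_bigr => j _;
  rewrite addnC.
Qed.

(* Edge r of round q has rank q * P + r, and each row is a block of s
   consecutive ranks; for s = P no block meets two rounds. *)
Lemma window_cases q r q' r' P s :
  0 < s <= P -> r < P -> r' < P ->
  (q * P + r) %/ s = (q' * P + r') %/ s ->
  [\/ q = q' /\ (r < r' + s /\ r' < r + s),
      q' = q.+1 /\ (P + r' < r + s /\ s < P) |
      q = q'.+1 /\ (P + r < r' + s /\ s < P)].
Proof.
move=> /andP[s0 sP] rP rP' same.
have [eP|neP] := eqVneq s P.
  by move: same; rewrite eP !divnMDl ?divn_small //; try lia; move=> h; constructor 1; lia.
have h1 := divn_eq (q * P + r) s; have h2 := divn_eq (q' * P + r') s.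
have m1 := ltn_pmod (q * P + r) s0; have m2 := ltn_pmod (q' * P + r') s0.
rewrite same in h1.
have [lt|gt|eq] := ltngtP q q'.
- have [] : q' = q.+1 \/ q.+2 <= q' by lia.
    by move=> e; subst q'; rewrite mulSn in h2; constructor 2; lia.
  (* Ranks two or more rounds apart differ by more than P, hence do not share a block. *)
  by move=> h; have := leq_mul h (leqnn P); rewrite !mulSn; lia.
- have [] : q = q'.+1 \/ q'.+2 <= q by lia.
    by move=> e; subst q; rewrite mulSn in h1; constructor 3; lia.
  by move=> h; have := leq_mul h (leqnn P); rewrite !mulSn; lia.
by subst q'; constructor 1; lia.
Qed.

Section Grid.
Variables (m n s k K P : nat) (tl hd : nat -> nat -> nat) (L : nat -> nat -> int).
Hypotheses (s0 : 0 < s) (mKP : m * s = K * P) (labL : labelling K P L).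
Hypotheses (tl_lt : forall q r, q < K -> r < P -> tl q r < n)
           (hd_lt : forall q r, q < K -> r < P -> hd q r < n).
Hypothesis matching : forall q r q' r', q < K -> r < P -> q' < K -> r' < P ->
  (q * P + r) %/ s = (q' * P + r') %/ s ->
  [/\ tl q r <> hd q' r', tl q r = tl q' r' -> q = q' /\ r = r'
    & hd q r = hd q' r' -> q = q' /\ r = r'].
Hypothesis degree : forall j, j < n ->
  \sum_(q < K) \sum_(r < P) ((tl q r == j) + (hd q r == j)) = k.
Hypothesis flow : forall j, j < n ->
  (\sum_(q < K) \sum_(r < P) ((tl q r == j)%:Z - (hd q r == j)%:Z) * L q r = 0)%R.

(** The edges are the pairs (q, r), and the row of an edge is its rank divided by [s]. *)
Lemma grid_iarray : exists f, iarray m n s.*2 k (K * P) f.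
Proof.
pose E := ('I_K * 'I_P)%type.
have cE : #|{: E}| = K * P by rewrite card_prod !card_ord.
case: labL => lb li.
have Ieq (e e' : E) : e.1 = e'.1 :> nat /\ e.2 = e'.2 :> nat -> e = e'.
  by case: e e' => [q r] [q' r'] /= [a b]; congr pair; apply: val_inj.
rewrite -cE; exists (fun i j => mg_cell (fun e : E => (e.1 * P + e.2) %/ s)
  (fun e => tl e.1 e.2) (fun e => hd e.1 e.2) (fun e => L e.1 e.2) i j).
apply: mg_iarray => [e e' re|e|e|e|i im|j jn|j jn|e|e e' /= h].
- have [a b c] := matching (ltn_ord _) (ltn_ord _) (ltn_ord _) (ltn_ord _) re.
  by split=> // h; apply: Ieq; [apply: b|apply: c].
- rewrite ltn_divLR // mKP; case: e => [q r] /=.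
  by have := leq_mul (ltn_ord q) (leqnn P); have := ltn_ord r; rewrite mulSn; lia.
- exact: tl_lt.
- exact: hd_lt.
- rewrite -(pair_bigA _ (fun (q : 'I_K) (r : 'I_P) => ((q * P + r) %/ s == i) : nat)) /=.
  (* The same KP ranks are regrouped from K rounds of P into m blocks of s. *)
  rewrite -(sum_block (fun t => t %/ s == i)) -mKP sum_block.
  rewrite (bigD1 (Ordinal im)) //= [X in _ + X]big1 ?addn0 => [|i' ne].
    rewrite (eq_bigr (fun=> 1)) ?sum1_card ?card_ord // => j _.
    by rewrite divnMDl // divn_small ?addn0 ?eqxx.
  apply: big1 => j _; rewrite divnMDl // divn_small ?addn0 //.
  by apply/eqP; rewrite eqb0; move: ne; rewrite -val_eqE.
- by rewrite -(degree jn) -(pair_bigA _ (fun (q : 'I_K) (r : 'I_P) => (tl q r == j) + (hd q r == j))).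
- rewrite -[RHS](flow jn).
  by rewrite -(pair_bigA _ (fun (q : 'I_K) (r : 'I_P) => (((tl q r == j)%:Z - (hd q r == j)%:Z) * L q r)%R)).
- by rewrite cE; apply: lb.
- exact/Ieq/li.
Qed.
End Grid.

(** * Extending labellings by rows and columns *)

Definition colsum K (L : nat -> nat -> int) r : int := (\sum_(q < K) L q r)%R.

(** The next 2P labels fill two rows in the same order with opposite signs, so every column sum
    changes by the same amount, P or -P according to [neg]. *)
Definition add_two_rows K P (neg : bool) (L : nat -> nat -> int) q r : int :=
  if q < K then L q r else
  if (q == K) (+) neg then Posz (q * P + r).+1 else (- Posz (q * P + r).+1)%R.

Lemma add_two_rows_labelling K P neg L :
  labelling K P L -> labelling K.+2 P (add_two_rows K P neg L).
Proof.
case=> lb li.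
have abs q r : r < P -> K <= q -> `|add_two_rows K P neg L q r|%N = (q * P + r).+1.
  by move=> rP Kq; rewrite /add_two_rows ltnNge Kq; case: ifP => _; rewrite ?abszN.
have old q r : q < K -> add_two_rows K P neg L q r = L q r.
  by rewrite /add_two_rows => ->.
have inj q r q' r' : r < P -> r' < P -> q * P + r = q' * P + r' -> q = q' /\ r = r'.
  move=> rP rP' e; have P0 : 0 < P by lia.
  have := congr1 (divn^~ P) e; rewrite !divnMDl // !divn_small // !addn0 => eq.
  by move: e; rewrite eq; lia.
split=> [q r qK rP|q r q' r' qK rP qK' rP'].
  have [qk|qk] := ltnP q K.
    by rewrite old //; have := lb q r qk rP; rewrite !mulSn; lia.
  by rewrite abs //; have := @leq_mul q P K.+1 P qK (leqnn _); rewrite !mulSn; lia.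
have [qk|qk] := ltnP q K; have [qk'|qk'] := ltnP q' K.
- by rewrite !old //; exact: li.
- rewrite old // abs // => e; have := lb q r qk rP; rewrite e.
  by have := leq_mul qk' (leqnn P); lia.
- rewrite (old q') // abs // => e; have := lb q' r' qk' rP'; rewrite -e.
  by have := leq_mul qk (leqnn P); lia.
by rewrite !abs // => -[]; exact: inj.
Qed.

Lemma add_two_rows_colsum K P neg L r :
  colsum K.+2 (add_two_rows K P neg L) r =
  (colsum K L r + (if neg then Posz P else - Posz P))%R.
Proof.
rewrite /colsum !big_ord_recr /= -addrA; congr (_ + _)%R.
  by apply: eq_bigr => q _; rewrite /add_two_rows ltn_ord.
rewrite /add_two_rows ltnn eqxx ltnNge leqnSn /= gtn_eqF //.
by rewrite mulSn; case: neg => /=; lia.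
Qed.

(** Two pairs of rows with opposite [neg] cancel, so column sums are kept four rows at a time. *)
Lemma add_rows K P L c : labelling K P L ->
  exists L', [/\ labelling (K + 4 * c) P L', forall q r, q < K -> L' q r = L q r &
    forall r, colsum (K + 4 * c) L' r = colsum K L r].
Proof.
move=> labL; elim: c => [|c [L' [lab' old cs]]]; first by exists L; rewrite muln0 addn0.
have -> : K + 4 * c.+1 = (K + 4 * c).+4 by lia.
set K' := K + 4 * c in lab' cs *.
exists (add_two_rows K'.+2 P true (add_two_rows K' P false L')); split.
- by do 2!apply: add_two_rows_labelling.
- move=> q r qK; have qK' : q < K' by rewrite /K'; lia.
  by rewrite /add_two_rows (ltn_trans qK') // qK' old.
- by move=> r; rewrite !add_two_rows_colsum cs; lia.
Qed.

(* 1 + 3 + 7 = 2 + 4 + 5 and 6 + 10 + 12 = 8 + 9 + 11; as many labels are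
   positive as negative, so shifting all absolute values keeps the sums zero. *)
Definition twelve_labels q r : int :=
  nth 0%R (nth [::] [:: [:: 1; -2; 3; -4; -5; 7];
                        [:: 6; -8; -9; 10; -11; 12]]%Z r) q.

Definition add_two_columns P (L : nat -> nat -> int) q r : int :=
  if r < P then L q r else
  let x := twelve_labels q (r - P) in
  if (0 <= x)%R then (Posz (6 * P) + x)%R else (x - Posz (6 * P))%R.

Lemma ltn6 q : q < 6 -> [\/ q = 0, q = 1, q = 2 | [\/ q = 3, q = 4 | q = 5]].
Proof.
by move: q => [|[|[|[|[|[|q]]]]]] //= _; do ?[by constructor];
  constructor 4; constructor.
Qed.

Lemma add_two_columns_labelling P L :
  labelling 6 P L -> labelling 6 (P + 2) (add_two_columns P L).
Proof.
case=> lb li.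
have new q r : q < 6 -> P <= r < P + 2 ->
    `|add_two_columns P L q r|%N = 6 * P + `|twelve_labels q (r - P)|%N.
  by move=> q6 rP; rewrite /add_two_columns ltnNge; case/andP: rP => -> _ /=; case: ifP; lia.
have old q r : r < P -> add_two_columns P L q r = L q r.
  by rewrite /add_two_columns => ->.
have tb q b : q < 6 -> b < 2 -> 0 < `|twelve_labels q b|%N <= 12.
  by case: b => [|[|b]] // /ltn6[->|->|->|[->|->|->]].
split=> [q r qK rP|q r q' r' qK rP qK' rP'].
  have [rp|rp] := ltnP r P; first by rewrite old //; have := lb q r qK rp; lia.
  by rewrite new ?rp //; have := @tb q (r - P) qK; lia.
have [rp|rp] := ltnP r P; have [rp'|rp'] := ltnP r' P.
- by rewrite !old //; exact: li.
- rewrite old // new ?rp' // => e; have := lb q r qK rp.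
  by have := @tb q' (r' - P) qK'; lia.
- rewrite (old q') // new ?rp // => e; have := lb q' r' qK' rp'.
  by have := @tb q (r - P) qK; lia.
rewrite !new ?rp ?rp' // => /addnI.
have [b eb b2] : exists2 b, r = P + b & b < 2 by exists (r - P); lia.
have [b' eb' b2'] : exists2 b, r' = P + b & b < 2 by exists (r' - P); lia.
rewrite {}eb {}eb' !addKn.
move: b b' b2 b2' => [|[|b]] [|[|b']] // _ _; move: qK qK';
  by move=> /ltn6[->|->|->|[->|->|->]] /ltn6[->|->|->|[->|->|->]].
Qed.

Lemma add_two_columns_colsum P L r : P <= r < P + 2 ->
  colsum 6 (add_two_columns P L) r = 0%R.
Proof.
move=> rP; have [->|->] : r = P \/ r = P + 1 by lia.
  by rewrite /colsum !big_ord_recl big_ord0 /add_two_columns ltnn subnn /twelve_labels /=; lia.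
rewrite /colsum !big_ord_recl big_ord0 /add_two_columns ltnNge leq_addr addKn.
by rewrite /twelve_labels /=; lia.
Qed.

Lemma add_columns P L c : labelling 6 P L ->
  exists L', [/\ labelling 6 (P + 2 * c) L',
    forall q r, r < P -> L' q r = L q r &
    forall r, P <= r < P + 2 * c -> colsum 6 L' r = 0%R].
Proof.
move=> labL; elim: c => [|c [L' [lab' old cs]]].
  by exists L; rewrite muln0 addn0; split=> // r; lia.
have -> : P + 2 * c.+1 = (P + 2 * c) + 2 by lia.
set P' := P + 2 * c in lab' cs *.
have keep q r : r < P' -> add_two_columns P' L' q r = L' q r.
  by rewrite /add_two_columns => ->.
exists (add_two_columns P' L'); split.
- exact: add_two_columns_labelling.
- by move=> q r rP; rewrite keep ?old // /P'; lia.
move=> r rP; have [r'|r'] := ltnP r P'; last by apply: add_two_columns_colsum; lia.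
by rewrite -[RHS](cs r); [apply: eq_bigr => q _; rewrite keep|lia].
Qed.

(** * Multigraphs made of perfect matchings *)

(** Each round is a perfect matching: column [j] lies on the single edge [ed q j] of round [q], as
    its head when [neg q j]. Hence the degree is K and the flow at [j] is one signed sum over the
    rounds. *)
Lemma perfect_iarray m n s K P (tl hd ed : nat -> nat -> nat)
    (neg : nat -> nat -> bool) L :
  0 < s -> m * s = K * P -> labelling K P L ->
  (forall q r, q < K -> r < P -> tl q r < n /\ hd q r < n) ->
  (forall q r q' r', q < K -> r < P -> q' < K -> r' < P ->
    (q * P + r) %/ s = (q' * P + r') %/ s ->
    [/\ tl q r <> hd q' r', tl q r = tl q' r' -> q = q' /\ r = r'
      & hd q r = hd q' r' -> q = q' /\ r = r']) ->
  (forall q j, j < n -> ed q j < P) ->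
  (forall q r j, (tl q r == j) = (ed q j == r) && ~~ neg q j) ->
  (forall q r j, (hd q r == j) = (ed q j == r) && neg q j) ->
  (forall j, j < n ->
    (\sum_(q < K) (if neg q j then - L q (ed q j) else L q (ed q j)) = 0)%R) ->
  exists f, iarray m n s.*2 K (K * P) f.
Proof.
move=> s0 mKP labL bnd mat edP etl ehd flow.
apply: (@grid_iarray m n s K K P tl hd L) => //.
- by move=> q r qK rP; case: (bnd q r qK rP).
- by move=> q r qK rP; case: (bnd q r qK rP).
- move=> j jn; rewrite (eq_bigr (fun=> 1)) ?sum1_card ?card_ord // => q _.
  rewrite -(sum_ord_eq (edP q j jn)); apply: eq_bigr => r _.
  by rewrite etl ehd; case: eqP; case: (neg q j).
move=> j jn; rewrite -[RHS](flow j jn); apply: eq_bigr => q _.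
rewrite -(sum_ord_pick (fun r => if neg q j then - L q r else L q r)%R (edP q j jn)).
apply: eq_bigr => r _; rewrite etl ehd.
by case: eqP; case: (neg q j); rewrite ?mul0r //= ?sub0r ?subr0 ?mulN1r ?mul1r.
Qed.

(** Every round is the matching of 2r with 2r+1. Parallel edges are at least p ranks apart, so with
    s <= p no row contains two of them. *)
Lemma matching_iarray m p s k L :
  0 < s <= p -> m * s = k * p -> labelling k p L ->
  (forall r, r < p -> colsum k L r = 0%R) ->
  exists f, iarray m p.*2 s.*2 k (k * p) f.
Proof.
move=> sp mkp labL cs; have /andP[s0 _] := sp.
apply: (@perfect_iarray m p.*2 s k p (fun _ r => r.*2) (fun _ r => r.*2.+1)
  (fun _ j => j./2) (fun _ j => odd j) L) => //.
- by move=> q r _ rP; lia.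
- by move=> q r q' r' _ rP _ rP' /(window_cases sp rP rP') [[<- hr]|[-> hr]|[-> hr]]; split; lia.
- by move=> q j jn; lia.
- by move=> q r j; lia.
- by move=> q r j; lia.
move=> j jn; have jp : j./2 < p by lia.
have := cs _ jp; rewrite /colsum => h.
by case: (odd j); rewrite /= ?sumrN h ?oppr0.
Qed.

(* Rounds 0, 1 and q >= 6 use the matching {01, 23} of the K4 on the columns
   0..3, rounds 2, 3 use {02, 13} and rounds 4, 5 use {03, 12}. *)
Definition K4_row q := 2 <= q < 6.
Definition K4_tail q r := if K4_row q && (r < 2) then r else r.*2.
Definition K4_head q r :=
  if K4_row q && (r < 2) then (if q < 4 then r + 2 else 3 - r) else r.*2.+1.
Definition K4_edge q j :=
  if K4_row q && (j < 4) then nat_of_bool (if q < 4 then odd j else 0 < j < 3)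
  else j./2.
Definition K4_neg q j := if K4_row q && (j < 4) then 2 <= j else odd j.

Lemma sum_split6 (F : nat -> int) c : (\sum_(q < 6 + c) F q =
  F 0%N + F 1%N + F 2%N + F 3%N + F 4%N + F 5%N + \sum_(q < c) F (6 + q)%N)%R.
Proof. by rewrite big_split_ord /= !big_ord_recl big_ord0 addr0 !addrA. Qed.

(** The flow equations at columns 0..3 add up to a trivial identity. Column 0 is the zero sum of
    label column 0; given it, the next hypothesis is the equation at column 1, the last one that at
    column 3, and column 2 follows. *)
Lemma K4_iarray m p s c L :
  0 < s <= p -> 2 < p -> m * s = (6 + c) * p -> labelling (6 + c) p L ->
  (forall r, r < p -> r != 1 -> colsum (6 + c) L r = 0%R) ->
  (L 2%N 0%N + L 3%N 0%N + L 4%N 0%N + L 5%N 0%N + L 2%N 1%N + L 3%N 1%N + L 4%N 1%N + L 5%N 1%N = 0)%R ->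
  (colsum (6 + c) L 1%N = L 4%N 1%N + L 5%N 1%N - L 4%N 0%N - L 5%N 0%N)%R ->
  exists f, iarray m p.*2 s.*2 (6 + c) ((6 + c) * p) f.
Proof.
move=> sp p2 mkp labL cs h0 h1; have /andP[s0 _] := sp.
apply: (@perfect_iarray m p.*2 s (6 + c) p K4_tail K4_head K4_edge K4_neg L) => //.
- move=> q r _ rP; rewrite /K4_tail /K4_head.
  by case: ifP => h; split; try case: ifP; lia.
(* If a row holds edge r of one round and r' of the next, then r >= r' + 2. So two edges with index
   below 2 in a common row belong to the same round. *)
- move=> q r q' r' _ rP _ rP' /(window_cases sp rP rP') [[<- hr]|[-> hr]|[-> hr]];
  by rewrite /K4_tail /K4_head /K4_row; do ?case: ifP; move=> *; split; lia.
- by move=> q j jn; rewrite /K4_edge; do ?case: ifP; lia.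
- by move=> q r j; rewrite /K4_tail /K4_edge /K4_neg /K4_row; do ?case: ifP; lia.
- by move=> q r j; rewrite /K4_head /K4_edge /K4_neg /K4_row; do ?case: ifP; lia.
move=> j jn; have [j4|j4] := leqP 4 j.
  rewrite /K4_neg /K4_edge !(leqNgt j.+1) !ltnS !j4.
  under eq_bigr => q _ do rewrite andbF.
  have := cs j./2; rewrite /colsum => h.
  by case: (odd j); rewrite /= ?sumrN h ?oppr0 //; lia.
have c0 := cs 0 (ltnW (ltnW p2)) isT.
rewrite /colsum !(sum_split6 (fun q => L q _)) in c0 h1.
rewrite (sum_split6 (fun q => if K4_neg q j then - L q (K4_edge q j) else L q (K4_edge q j))%R).
set X0 : int := bigop _ _ _ in c0; set X1 : int := bigop _ _ _ in h1.
have X0N : (\sum_(i < c) - L (6 + i)%N 0%N = - X0)%R by rewrite sumrN.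
have X1N : (\sum_(i < c) - L (6 + i)%N 1%N = - X1)%R by rewrite sumrN.
move: j j4 {jn} => [|[|[|[|j]]]] //= _; rewrite /K4_neg /K4_edge /K4_row /=
  ?X0N ?X1N -?/X0 -?/X1; lia.
Qed.

(** * The Hamiltonian cycle with multiplicities *)

(** Edge [r] joins 2r and 2r+1 mod n. For odd n this order skips every other edge and goes twice
    round the cycle, so any (n-1)/2 cyclically consecutive edges are disjoint. *)
Definition cycle_tail n r := if r.*2 < n then r.*2 else r.*2 - n.
Definition cycle_head n r := if r.*2.+1 < n then r.*2.+1 else r.*2.+1 - n.

(** Every edge of the cycle carries the total flow [X], so inflow and outflow agree at each
    column. *)
Lemma cycle_iarray m n s h L (X : int) :
  odd n -> 0 < s -> s.*2 < n -> m * s = h * n -> labelling h n L ->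
  (forall r, r < n -> colsum h L r = X) ->
  exists f, iarray m n s.*2 h.*2 (h * n) f.
Proof.
move=> on s0 sn mhn labL cs.
have sn' : 0 < s <= n by lia.
have tlE j : j < n -> exists2 r0, r0 < n & forall r, r < n ->
    (cycle_tail n r == j) = (r0 == r).
  move=> jn; exists (if odd j then (j + n)./2 else j./2); first by case: ifP; lia.
  by move=> r rn; rewrite /cycle_tail; do 2!case: ifP; lia.
have hdE j : j < n -> exists2 r0, r0 < n & forall r, r < n ->
    (cycle_head n r == j) = (r0 == r).
  (* The solution of 2r = j modulo the odd number n. *)
  move=> jn; exists (if odd j then j./2 else (j + n)./2); first by case: ifP; lia.
  by move=> r rn; rewrite /cycle_head; do 2!case: ifP; lia.
apply: (@grid_iarray m n s h.*2 h n (fun=> cycle_tail n) (fun=> cycle_head n) L) => //.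
- by move=> _ r _ rn; rewrite /cycle_tail; case: ifP; lia.
- by move=> _ r _ rn; rewrite /cycle_head; case: ifP; lia.
- move=> q r q' r' _ rP _ rP' /(window_cases sn' rP rP') [[<- hr]|[-> hr]|[-> hr]];
  by rewrite /cycle_tail /cycle_head; do ?case: ifP; move=> *; split; lia.
- move=> j jn; have [a aP aE] := tlE j jn; have [b bP bE] := hdE j jn.
  rewrite (eq_bigr (fun=> 2)) ?sum_nat_const ?card_ord ?muln2 // => q _.
  rewrite big_split /= -[RHS]/(1 + 1) -{1}(sum_ord_eq aP) -(sum_ord_eq bP).
  by congr (_ + _); apply: eq_bigr => r _; rewrite ?aE ?bE.
move=> j jn; have [a aP aE] := tlE j jn; have [b bP bE] := hdE j jn.
rewrite exchange_big /= (eq_bigr (fun r : 'I_n => (a == r)%:Z * X - (b == r)%:Z * X)%R).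
  by rewrite sumrB !(sum_ord_pick (fun=> X)) // subrr.
move=> r _; rewrite -big_distrr /= -mulrBl -aE -?bE //; congr (_ * _)%R; exact: cs.
Qed.

(** * Labellings with prescribed column sums *)

(* With n = 2p+1, the sums r + kotzig r are n consecutive integers, so they
   can be cancelled by a third permutation up to a constant. *)
Definition kotzig p r := if r <= p then p + r else r - p.+1.

Definition kotzig_labels p q r : int :=
  if q == 0 then Posz r.+1
  else if q == 1 then Posz (p.*2.+1 + kotzig p r).+1
  else (- Posz (p.*2.+1 + p.*2.+1 + (r + kotzig p r - p)).+1)%R.

Lemma ltn3 q : q < 3 -> [\/ q = 0, q = 1 | q = 2].
Proof. by move: q => [|[|[|q]]] //= _; constructor. Qed.

Lemma kotzig_labelling p : labelling 3 p.*2.+1 (kotzig_labels p).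
Proof.
split=> [q r /ltn3[->|->|->] rn|q r q' r' /ltn3[->|->|->] rn /ltn3[->|->|->] rn'];
  by rewrite /kotzig_labels /kotzig /=; do ?case: ifP; lia.
Qed.

Lemma kotzig_colsum p r : r < p.*2.+1 -> colsum 3 (kotzig_labels p) r = (- Posz p.*2.+1 + Posz p.+1)%R.
Proof.
move=> rn; rewrite /colsum !big_ord_recl big_ord0 /kotzig_labels /kotzig /=.
by case: ifP; lia.
Qed.

(** Start from no row or from the three Kotzig rows, by the parity of h; each further pair of rows
    shifts all column sums by -n. *)
Lemma cycle_labelling n h : odd n -> 1 < h ->
  exists (L : nat -> nat -> int) X, labelling h n L /\ forall r, r < n -> colsum h L r = X.
Proof.
move=> on h1.
have [c [b hE]] : exists c b, h = (if b then 0 else 3) + c.*2.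
  exists (if odd h then (h - 3)./2 else h./2), (~~ odd h).
  by case: (boolP (odd h)) => /=; lia.
have [L [X [labL cs]]] : exists (L : nat -> nat -> int) X,
    labelling (if b then 0 else 3) n L /\
    forall r, r < n -> colsum (if b then 0 else 3) L r = X.
  case: (b); first by exists (fun _ _ => 0%R), 0%R; split=> // r _; rewrite /colsum big_ord0.
  have -> : n = n./2.*2.+1 by lia.
  exists (kotzig_labels n./2), (- Posz n./2.*2.+1 + Posz n./2.+1)%R.
  by split; [exact: kotzig_labelling|exact: kotzig_colsum].
rewrite {h1}hE; elim: c => [|c [L' [X' [lab' cs']]]].
  by exists L, X; rewrite double0 addn0.
rewrite doubleS !addnS.
exists (add_two_rows ((if b then 0 else 3) + c.*2) n false L'), (X' - Posz n)%R; split.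
  exact: add_two_rows_labelling.
by move=> r rn; rewrite add_two_rows_colsum cs'.
Qed.

(** If 4 divides k, all rows come in groups of four. Otherwise six rows with zero column sums are
    built two columns at a time, which uses that p is even, and groups of four rows follow. *)
Lemma matching_labelling p k : 4 %| k \/ [/\ ~~ odd k, 6 <= k & ~~ odd p] ->
  exists L, labelling k p L /\ forall r, r < p -> colsum k L r = 0%R.
Proof.
move=> kp.
have [c [kE|[kE ep]]] : exists c, k = 0 + 4 * c \/ k = 6 + 4 * c /\ ~~ odd p.
  case: kp => [/dvdnP[c ->]|[ek k6 ep]]; first by exists c; lia.
  have [d4|nd4] := boolP (4 %| k); first by exists (k %/ 4); lia.
  by exists ((k - 6) %/ 4); lia.
  have labz : labelling 0 p (fun _ _ => 0%R) by [].
  have [L [labL _ cs]] := add_rows c labz.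
  by exists L; rewrite kE; split=> // r _; rewrite cs /colsum big_ord0.
have labz : labelling 6 0 (fun _ _ => 0%R) by [].
have [L [labL _ cs]] := add_columns p./2 labz.
have pE : 0 + 2 * p./2 = p by lia.
rewrite pE in labL cs.
have [L' [labL' _ cs']] := add_rows c labL.
by exists L'; rewrite kE; split=> // r rp; rewrite cs' cs.
Qed.

(* Found by computer search: columns 0 and 1 label the edges of the K4, column
   2 sums to 0. *)
Definition K4_labels q r : int :=
  nth 0%R (nth [::] [:: [:: -10; -5; -7]; [:: 8; -4; -6]; [:: 1; 11; 14];
    [:: -13; -16; 2]; [:: -3; 18; 9]; [:: 17; -15; -12]]%Z q) r.

Lemma K4_labels_labelling : labelling 6 3 K4_labels.
Proof.
by split=> [q r /ltn6[->|->|->|[->|->|->]] /ltn3[->|->|->]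
  |q r q' r' /ltn6[->|->|->|[->|->|->]] /ltn3[->|->|->]
             /ltn6[->|->|->|[->|->|->]] /ltn3[->|->|->]].
Qed.

(** The 6 by 3 block is widened by pairs of zero-sum columns, then lengthened by groups of four
    rows. Both keep the block and its column sums, hence the two K4 equations. *)
Lemma K4_matching_labelling p c : odd p -> 2 < p ->
  exists L, [/\ labelling (6 + 4 * c) p L,
    forall r, r < p -> r != 1 -> colsum (6 + 4 * c) L r = 0%R,
    (L 2%N 0%N + L 3%N 0%N + L 4%N 0%N + L 5%N 0%N
      + L 2%N 1%N + L 3%N 1%N + L 4%N 1%N + L 5%N 1%N = 0)%R &
    (colsum (6 + 4 * c) L 1%N = L 4%N 1%N + L 5%N 1%N - L 4%N 0%N - L 5%N 0%N)%R].
Proof.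
move=> op p2; have pE : 3 + 2 * (p - 3)./2 = p by lia.
have [L [labL old cs]] := add_columns (p - 3)./2 K4_labels_labelling.
rewrite pE in labL cs; have [L' [labL' old' cs']] := add_rows c labL.
have LE q r : q < 6 -> r < 3 -> L' q r = K4_labels q r.
  by move=> q6 r3; rewrite old' // old.
have csE r : r < 3 -> colsum 6 L r = colsum 6 K4_labels r.
  by move=> r3; apply: eq_bigr => q _; exact: old.
exists L'; split=> //; rewrite ?cs' ?csE ?LE //.
- move=> r rp r1; rewrite cs'; have [r3|r3] := leqP 3 r; first by apply: cs; lia.
  rewrite csE //; case/ltn3: r3 r1 => -> //;
  by rewrite /colsum !big_ord_recl big_ord0.
by rewrite /colsum !big_ord_recl big_ord0.
Qed.

(** * Existence, up to transposition *)

Lemma iarray_exists m n s k :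
  ~~ odd s -> ~~ odd k -> 0 < s <= n -> m * s = n * k ->
  [\/ odd n /\ 4 <= k, ~~ odd n /\ 4 %| k | [/\ ~~ odd n, 4 <= n & 6 <= k]] ->
  exists f, iarray m n s k (n * k)./2 f.
Proof.
move=> es ek sn msnk cond.
have [s' sE] : exists s', s = s'.*2 by exists s./2; lia.
have [[on k4]|en] : (odd n /\ 4 <= k) \/ ~~ odd n by case: cond => [|[]|[]]; auto.
  have [h kE] : exists h, k = h.*2 by exists k./2; lia.
  have h1 : 1 < h by lia.
  have [L [X [labL cs]]] := cycle_labelling on h1.
  subst s k; rewrite -doubleMr doubleK mulnC.
  by apply: (@cycle_iarray m n s' h L X) => //; lia.
have [p nE] : exists p, n = p.*2 by exists n./2; lia.
have mskp : m * s' = k * p by move: msnk; rewrite sE nE; lia.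
have sp : 0 < s' <= p by lia.
have -> : (n * k)./2 = k * p by rewrite nE -doubleMl doubleK mulnC.
have [kp|nkp] := boolP ((4 %| k) || ((6 <= k) && ~~ odd p)).
  have [|L [labL cs]] := @matching_labelling p k; first by case/orP: kp => [|/andP[]]; [left|right].
  by rewrite sE nE; exact: matching_iarray labL cs.
(* What remains is n and k both 2 mod 4, with n, k >= 6: the K4 case. *)
move: nkp; rewrite negb_or negb_and => /andP[k4 /orP kp].
have [n4 k6] : 4 <= n /\ 6 <= k by case: cond => [[on _]|[_ d4]|[]] //; [rewrite on in en|rewrite d4 in k4].
have op : odd p by case: kp; lia.
have [c kE] : exists c, k = 6 + 4 * c by exists ((k - 6) %/ 4); lia.
have p2 : 2 < p by lia.
have [L [labL cs h0 h1]] := K4_matching_labelling c op p2.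
by rewrite sE nE kE; apply: K4_iarray h0 h1 => //; rewrite -kE.
Qed.

(** * From integer arrays to residues and back *)

Lemma card_set_sum (T : finType) (P : pred T) : #|[set x | P x]| = \sum_x P x.
Proof. by rewrite -sum1dep_card big_mkcond. Qed.

(** Serves for the sums in Z_v and, with v = 2, for a parity argument. *)
Lemma sum_modn_eq0 (I : finType) v (F b : I -> nat) (f : I -> int) :
  (forall i, Posz (F i) = f i + Posz (v * b i))%R -> (\sum_i f i = 0)%R ->
  (\sum_i F i) %% v = 0.
Proof.
move=> Fe f0; suff -> : \sum_i F i = v * \sum_i b i by rewrite modnMr.
apply/eqP; rewrite -eqz_nat big_distrr /= !(big_morph Posz PoszD (erefl _)).
by rewrite (eq_bigr _ (fun i _ => Fe i)) big_split /= f0 add0r.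
Qed.

Lemma pm_mult_sum m n v (A : parray m n v) r : pm_mult A r =
  \sum_i \sum_j ((A i j == Some r) +
    ((if A i j is Some x then (val x + val r) %% v == 0 else false) : bool)).
Proof.
rewrite /pm_mult !card_set_sum -big_split /=.
by rewrite (pair_bigA _ (fun i j => (A i j == Some r) +
    ((if A i j is Some x then (val x + val r) %% v == 0 else false) : bool))).
Qed.

(** As v is odd and r nonzero, r and -r differ, so at most one test on the left succeeds; their
    common absolute representative is r or v - r. *)
Lemma pm_mult_cell N v (y r : 'I_v) : v = N.*2.+1 -> 0 < r ->
  (Some y == Some r) + ((val y + val r) %% v == 0) =
  (`|irep (Some y)|%N == (if r <= N then r : nat else v - r)).
Proof.
move=> vE r0; have yv := ltn_ord y; have rv := ltn_ord r.
have -> : (Some y == Some r) = (y == r :> nat) by [].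
have -> : ((val y + val r) %% v == 0) = (y + r == v).
  rewrite /=; have [lt|ge] := ltnP (y + r) v; first by rewrite modn_small //; lia.
  by rewrite -{1}(subnK ge) modnDr modn_small; lia.
by rewrite /irep /=; do 2!case: ifP; lia.
Qed.

Lemma heffter2_iarray m n s k : ~~ odd k ->
  (exists A : parray m n (hv n k), integer_heffter2 m n s k A) <->
  (exists f, iarray m n s k (n * k)./2 f).
Proof.
move=> ek; set N := (n * k)./2.
have vE : hv n k = N.*2.+1 by rewrite /hv /N even_halfK // oddM (negbTE ek) andbF.
split=> [[A [[rs [cs [pm _]]] [r0 c0]]]|[f [rs cs fx fN [r0 c0]]]].
  have nz i j : (irep (A i j) != 0%R) = (A i j != None).
    case Aij: (A i j) => [y|] //=.
    (* A filled cell with entry 0 would give 0 a positive multiplicity. *)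
    have : (Some y : option 'I_(hv n k)) != Some ord0.
      apply/negP => /eqP y0; have := pm ord0; rewrite pm_mult_sum /=.
      by rewrite (bigD1 i) //= (bigD1 j) //= Aij y0 eqxx.
    have := ltn_ord y; case: y {Aij} => y /= yv _ y0.
    have {}y0 : y != 0 by apply: contra y0 => /eqP e; apply/eqP; congr Some; exact: val_inj.
    by case: ifP; lia.
  exists (fun i j => irep (A i j)); split=> //.
  - by move=> i; apply: etrans (rs i); rewrite /row_filled card_set_sum; apply: eq_bigr => j _; rewrite nz.
  - by move=> j; apply: etrans (cs j); rewrite /col_filled card_set_sum; apply: eq_bigr => i _; rewrite nz.
  - move=> x xN; have xv : x < hv n k by lia.
    have := pm (Ordinal xv); rewrite pm_mult_sum /= [x == 0]gtn_eqF; last by lia.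
    move=> <-; apply: eq_bigr => i _; apply: eq_bigr => j _.
    case: (A i j) => [y|] /=; last by move: xN; case: (x).
    have x0 : 0 < (Ordinal xv : nat) by case/andP: xN.
    by rewrite (pm_mult_cell y vE x0) /=; case/andP: xN => _ ->.
  - by move=> i j; case: (A i j) => [y|] //=; have := ltn_ord y; case: ifP; lia.
pose res (x : int) := if (0 <= x)%R then `|x|%N else hv n k - `|x|%N.
pose A i j : option 'I_(hv n k) := if f i j == 0%R then None else Some (inord (res (f i j))).
have resK i j : f i j != 0%R -> val (inord (res (f i j)) : 'I_(hv n k)) = res (f i j).
  by move=> fz; rewrite /= inordK //; have := fN i j; rewrite /res; case: ifP; lia.
have irepK i j : irep (A i j) = f i j.
  rewrite /A; case: eqP => [->|/eqP fz] //; rewrite /irep resK //.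
  by have := fN i j; rewrite /res; do 2!case: ifP; lia.
have fill i j : (A i j != None) = (f i j != 0%R).
  by rewrite /A; case: ifPn.
have cvalE i j : Posz (cval (A i j)) = (f i j + Posz (hv n k * (f i j < 0)%R))%R.
  rewrite /A; case: eqP => [->|/eqP fz]; first by rewrite muln0.
  by rewrite /cval resK //; have := fN i j; rewrite /res; case: (ltrP (f i j) 0%R); lia.
exists A; split; last first.
  split=> [i|j]; [apply: etrans (r0 i)|apply: etrans (c0 j)];
  by apply: eq_bigr => ? _; exact: irepK.
split; first by move=> i; rewrite /row_filled card_set_sum; apply: etrans (rs i);
  apply: eq_bigr => j _; rewrite fill.
split; first by move=> j; rewrite /col_filled card_set_sum; apply: etrans (cs j);
  apply: eq_bigr => i _; rewrite fill.
split; last first.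
  split=> [i|j]; [apply: sum_modn_eq0 (r0 i)|apply: sum_modn_eq0 (c0 j)];
  by move=> ?; exact: cvalE.
move=> r; rewrite pm_mult_sum; case: (posnP (val r)) => [r0'|rpos].
  rewrite r0' /= big1 // => i _; apply: big1 => j _; rewrite /A; case: ifPn => // fz.
  have b : 0 < res (f i j) < hv n k by have := fN i j; rewrite /res; case: ifP; lia.
  have -> : (Some (inord (res (f i j))) == Some r) = false.
    by apply/negbTE/eqP => -[] /(congr1 val); rewrite resK // r0'; lia.
  by rewrite addn0 [nat_of_ord _]resK // modn_small; case/andP: b => //; case: (res _).
(* The multiplicity of r is the number of cells labelled, up to sign, by the smaller of r and v -
   r. *)
rewrite /= in rpos *; rewrite -[RHS](fx (if r <= N then r : nat else hv n k - r)); last first.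
  by have := ltn_ord r; case: ifP; lia.
apply: eq_bigr => i _; apply: eq_bigr => j _; rewrite -[in RHS]irepK.
case: (A i j) => [y|]; first exact: pm_mult_cell.
by have := ltn_ord r; case: ifP => /=; lia.
Qed.

(** * Necessity *)

Lemma iarray_count m n s k N f : iarray m n s k N f -> m * s = n * k.
Proof.
case=> rs cs _ _ _.
have : \sum_i \sum_j (f i j != 0%R) = \sum_j \sum_i (f i j != 0%R).
  exact: exchange_big.
rewrite (eq_bigr _ (fun i _ => rs i)) (eq_bigr _ (fun j _ => cs j)).
by rewrite !sum_nat_const !card_ord.
Qed.

Lemma iarray_le m n s k N f : 0 < m -> iarray m n s k N f -> s <= n.
Proof.
move=> m0 [rs _ _ _ _]; rewrite -(rs (Ordinal m0)) -[X in _ <= X]card_ord -sum1_card.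
by apply: leq_sum => j _; case: (_ != _).
Qed.

Lemma two_opposite n (g : 'I_n -> int) j :
  \sum_i (g i != 0%R) = 2 -> (\sum_i g i = 0)%R -> g j != 0%R ->
  exists2 j', j' != j & `|g j'|%N = `|g j|%N.
Proof.
rewrite (bigD1 j) //= => two sum0 gj; move: two; rewrite gj => -[] /eqP /sum_nat_eq1.
case=> j' [nj _ oth]; exists j' => //.
move: sum0; rewrite (bigD1 j) //= (bigD1 j') //= big1; first by rewrite addr0; lia.
move=> i /andP[ij ij']; apply/eqP; have := oth i ij' ij.
by case: (g i =P 0%R).
Qed.

(** A cell with entry 1 or -1 has its opposite both in its row and in its column: three cells for a
    label that occurs twice. *)
Lemma iarray_two_two m n N f : 0 < N -> ~ iarray m n 2 2 N f.
Proof.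
move=> N0 [rs cs fx _ [r0 c0]]; have := fx 1; rewrite N0 => /(_ isT) two.
have [/existsP[i /existsP[j /eqP fij]]|none] :=
    boolP [exists i, exists j, `|f i j|%N == 1]; last first.
  move: two; rewrite big1 // => i _; apply: big1 => j _.
  by move: none => /existsPn/(_ i)/existsPn/(_ j)/negbTE ->.
have nz : f i j != 0%R by move: fij; case: (f i j) => [[]|].
have [j' nj fj'] := two_opposite (rs i) (r0 i) nz.
have [i' ni fi'] := two_opposite (cs j) (c0 j) nz.
move: two; rewrite (bigD1 i) //= (bigD1 i') //= [X in X + _](bigD1 j) //=.
rewrite [X in _ + X + _](bigD1 j') //= [X in _ + (X + _)](bigD1 j) //=.
by rewrite fj' fi' fij eqxx; lia.
Qed.

(** Each row is x, -x, so the first column carries 1..m once each up to sign. Its sum 0 has the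
    parity of m(m+1)/2, which is odd for m = 2 mod 4. *)
Lemma iarray_two_columns m k f : ~~ odd m -> iarray m 2 2 k m f -> m %% 4 = 0.
Proof.
move=> em [rs cs fx fN [r0 c0]].
have once x : 0 < x <= m -> \sum_i (`|f i ord0|%N == x) = 1.
  move=> xm; have := fx x xm.
  rewrite (eq_bigr (fun i => (`|f i ord0|%N == x) * 2)) => [|i _].
    by rewrite -big_distrl /=; lia.
  rewrite !big_ord_recl big_ord0 addn0; have := r0 i.
  rewrite !big_ord_recl big_ord0 addr0 => h.
  have -> : `|f i (lift ord0 ord0)|%N = `|f i ord0|%N by lia.
  by rewrite addnn muln2.
pose negpart (z : int) := if (0 <= z)%R then 0 else `|z|%N.
have absE (z : int) : Posz `|z|%N = (z + Posz (2 * negpart z))%R.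
  by rewrite /negpart; case: ifP; lia.
have parity := sum_modn_eq0 (fun i => absE (f i ord0)) (c0 ord0).
have totE : \sum_i `|f i ord0|%N = \sum_(x < m.+1) x.
  (* Each absolute value is expanded over its possible values x, and each positive x occurs once. *)
  transitivity (\sum_i \sum_(x < m.+1) x * (`|f i ord0|%N == x)).
    apply: eq_bigr => i _; rewrite (bigD1 (Ordinal (fN i ord0 : _ < m.+1))) //= eqxx muln1.
    rewrite big1 ?addn0 // => x; rewrite -val_eqE /= eq_sym => /negbTE ->.
    by rewrite muln0.
  rewrite exchange_big /=; apply: eq_bigr => x _; rewrite -big_distrr /=.
  by case: (posnP x) => [->|x0] //; rewrite once ?muln1 // x0 -ltnS ltn_ord.
move: parity; rewrite totE -(big_mkord predT id) bin2_sum.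
have := mul_bin_diag m.+1 1; rewrite bin1 /=.
have [h|[b ->]] : m %% 4 = 0 \/ exists b, m = 4 * b + 2 by
  case: (eqVneq (m %% 4) 0) => h; [left|right; exists (m %/ 4)]; lia.
  by [].
by move: 'C(_, _) => d; nia.
Qed.

Lemma iarray_two_row m n s k f :
  ~~ odd k -> 0 < k -> 1 < n -> iarray m n s k (n * k)./2 f -> s = 2 ->
  (n = 2 /\ m = k /\ k %% 4 = 0) \/ (3 <= n /\ 3 <= k).
Proof.
move=> ek k0 n1 fA s2; rewrite s2 in fA; have mk := iarray_count fA.
have [k2|k2] := eqVneq k 2.
  by rewrite k2 in fA; case: (@iarray_two_two _ _ _ _ _ fA); lia.
have [n2|n2] := eqVneq n 2; last by right; lia.
left; have mkE : m = k by lia.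
subst n; subst m; rewrite mul2n doubleK in fA; split=> //; split=> //.
exact: iarray_two_columns fA.
Qed.

(** * The characterization *)

Theorem theorem4 (m n s k : nat) :
  0 < m -> 0 < n -> 0 < s -> 0 < k -> ~~ odd s -> ~~ odd k ->
  (exists A : parray m n (hv n k), integer_heffter2 m n s k A) <->
  [/\ m * s = n * k, 2 <= s <= n, 2 <= k <= m,
      (s = 2 -> (n = 2 /\ m = k /\ k %% 4 = 0) \/ (3 <= n /\ 3 <= k)) &
      (k = 2 -> (m = 2 /\ n = s /\ s %% 4 = 0) \/ (3 <= m /\ 3 <= s))].
Proof.
move=> m0 n0 s0 k0 es ek; rewrite (heffter2_iarray _ _ _ ek).
split=> [[f fA]|[mk /andP[s2 sn] /andP[k2 km] cs ck]].
  have mk := iarray_count fA; have fT := iarray_tr fA.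
  have sn := iarray_le m0 fA; have km := iarray_le n0 fT.
  split=> //; [lia|lia|apply: iarray_two_row fA => //; lia|].
  by rewrite -mk in fT; apply: iarray_two_row fT => //; lia.
(* The array or its transpose meets the conditions of [iarray_exists]; the transpose is taken
   exactly when k = 2. *)
have [] : [\/ odd n /\ 4 <= k, ~~ odd n /\ 4 %| k | [/\ ~~ odd n, 4 <= n & 6 <= k]] \/
          [\/ odd m /\ 4 <= s, ~~ odd m /\ 4 %| s | [/\ ~~ odd m, 4 <= m & 6 <= s]].
- have [ke|ke] := eqVneq k 2.
    right; have [[-> [_ s4]]|[m3 s3]] := ck ke; first by constructor 2; lia.
    have [om|em] := boolP (odd m); first by constructor 1; lia.
    have [d|d] := boolP (4 %| s); first by constructor 2.
    by constructor 3; split=> //; lia.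
  left; have [on|en] := boolP (odd n); first by constructor 1; lia.
  have [d|d] := boolP (4 %| k); first by constructor 2.
  constructor 3; split=> //; last by lia.
  have [se|se] := eqVneq s 2; last by lia.
  by case: (cs se); lia.
- by apply: iarray_exists => //; rewrite s0.
move=> c; have [|f fA] := iarray_exists ek es _ (esym mk) c; first by rewrite k0.
by exists (fun i j => f j i); rewrite -mk; exact: iarray_tr.
Qed.
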